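(* Let $G$ be a graph of order at least three. If $G$ is $16$-tough, then it admits a $2$-connected $\{2,3\}$-factor, provided that $G$ admits a $2$-factor with girth at least five.
   Context: Graphs are finite, have no loops, and may have multiple edges. For a set $A$ of integers, an $A$-factor of $G$ is a spanning subgraph all of whose vertex degrees lie in $A$; a $2$-factor is a spanning subgraph in which every vertex has degree $2$ (its girth is the length of its shortest cycle). For a positive real $t$, $G$ is $t$-tough if $\omega(G\setminus S)\le\max\{1,\frac1t|S|\}$ for all $S\subseteq V(G)$, where $\omega$ denotes the number of components and $G\setminus S$ is obtained by deleting the vertices of $S$. A $2$-connected graph (on at least three vertices) is a connected graph without cut vertices. *)

(* Defs.v *)
From HB Require Import structures.
From mathcomp Require Import all_boot all_order all_algebra.
From mathcomp Require Import reals.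
Set Implicit Arguments.
Unset Strict Implicit.
Unset Printing Implicit Defensive.
Import Order.TTheory GRing.Theory Num.Theory.

(* Finite loopless multigraphs: distinct edges may have the same set of ends. *)
Record mgraph := MGraph {
  vertex : finType;
  edge : finType;
  ends : edge -> {set vertex};
  card_ends : forall e, #|ends e| = 2 }.

Definition graph_order (G : mgraph) : nat := #|vertex G|.

Definition degree (G : mgraph) (v : vertex G) : nat :=
  #|[set e : edge G | v \in ends e]|.

Definition adj_minus (G : mgraph) (S : {set vertex G}) : rel (vertex G) :=
  [rel u v | [&& u \notin S, v \notin S &
              [exists e : edge G, ends e == [set u; v]]]].

(* The number of components of G \ S; it is 0 when S contains every vertex. *)
Definition omega_minus (G : mgraph) (S : {set vertex G}) : nat :=
  n_comp (adj_minus S) (~: S).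

Definition tough (R : realType) (t : R) (G : mgraph) : Prop :=
  forall S : {set vertex G},
    ((omega_minus S)%:R <= Num.max 1 (1 / t * #|S|%:R))%R.

Definition graph_connected (G : mgraph) : Prop :=
  omega_minus (set0 : {set vertex G}) = 1.

Definition cut_vertex (G : mgraph) (v : vertex G) : Prop :=
  omega_minus (set0 : {set vertex G}) < omega_minus [set v].

Definition two_connected (G : mgraph) : Prop :=
  [/\ 3 <= graph_order G, graph_connected G & forall v : vertex G, ~ cut_vertex v].

(* Cyclically arranged distinct vertices and edges; ordS is the successor
   modulo k, and a pair of parallel edges is a cycle of length 2. *)
Definition has_cycle (G : mgraph) (k : nat) : Prop :=
  1 < k /\ exists (v : 'I_k -> vertex G) (e : 'I_k -> edge G),
    [/\ injective v, injective e &
        forall i, ends (e i) = [set v i; v (ordS i)]].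

(* A relation, since an acyclic graph has no girth. *)
Definition is_girth (G : mgraph) (g : nat) : Prop :=
  has_cycle G g /\ forall k, has_cycle G k -> g <= k.

Definition spanning_subgraph (G : mgraph) (F : {set edge G}) : mgraph :=
  @MGraph (vertex G) {e : edge G | e \in F}
    (fun e => ends (val e)) (fun e => card_ends (val e)).

Definition is_factor (A : {pred nat}) (G : mgraph) (F : {set edge G}) : Prop :=
  forall v : vertex (spanning_subgraph F), degree v \in A.

(* Main.v *)
Require Import Defs.
From HB Require Import structures.
From mathcomp Require Import all_boot all_order all_algebra.
From mathcomp Require Import reals.
From mathcomp Require Import zify.
Set Implicit Arguments.
Unset Strict Implicit.
Unset Printing Implicit Defensive.

(* Contract the cycles of the 2-factor F. It suffices to find a matching M whose image in the
   contracted graph is (2,2)-tight, i.e. has 2(m - 1) edges on the m cycles and at most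
   2(|X| - 1) edges inside each nonempty set X of cycles: then at least two edges of M cross
   each bipartition of the cycles, so F + M has no bridge, and a graph with degrees 2 and 3
   and no bridge has no cut vertex.
   Take a largest sparse matching M and suppose that it is too small. A local search in the
   style of Win's theorem on trees with bounded degrees gives a set S of M-saturated vertices
   such that every edge outside M avoiding S lies in a tight set of M \ S. Deleting S
   together with one end of each edge of M \ S that joins two maximal tight sets leaves almost
   as many components as there are maximal tight sets: since cycles have length at least
   five, few of these are deleted entirely. This contradicts 16-toughness. *)

(** * Auxiliary facts on finite sets *)

Lemma card_setI_exchange (T : finType) (A B D Z : {set T}) :
  #|A| = #|B| -> A :\: D = B :\: D -> D \subset Z -> #|A :&: Z| = #|B :&: Z|.
Proof.
move=> eqAB eqD sDZ; have eqZ: A :\: Z = B :\: Z.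
  by rewrite -(setUidPr sDZ) -!setDDl eqD.
by have := cardsID Z A; rewrite eqZ eqAB -(cardsID Z B) => /addIn.
Qed.

Lemma bigcup_card_le (T I : finType) (A : {set I}) (F : I -> {set T}) :
  #|\bigcup_(i in A) F i| <= \sum_(i in A) #|F i|.
Proof.
elim/big_rec2: _ => [|i n B _ le]; first by rewrite cards0.
by apply: leq_trans (leq_card_setU _ _) _; rewrite leq_add2l.
Qed.

(** If no iterate were fixed, each of the first [#|T|.+1] iterations would add an element, which is
    more than [T] contains. This is why the local search stops. *)
Lemma inflationary_fixpoint (T : finType) (f : {set T} -> {set T}) :
  (forall A : {set T}, A \subset f A) -> exists n, f (iter n f set0) = iter n f set0.
Proof.
move=> infl; case: (boolP [exists n : 'I_#|T|.+1, f (iter n f set0) == iter n f set0]).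
  by case/existsP=> n /eqP; exists n.
rewrite negb_exists => /forallP grow.
have lb n : n <= #|T|.+1 -> n <= #|iter n f set0|.
  elim: n => // n IH lt_n; apply: leq_ltn_trans (IH (ltnW lt_n)) _.
  by rewrite proper_card // properEneq infl eq_sym (grow (Ordinal lt_n)).
by have := leq_trans (lb _ (leqnn _)) (max_card _); rewrite ltnn.
Qed.

(** * Sparse sets of edges *)

Section Sparsity.

Variables (V N E : finType) (ends : E -> {set V}) (node : V -> N).
Hypothesis card_ends : forall e, #|ends e| = 2.
Implicit Types (M L D : {set E}) (X Y Q : {set N}) (S : {set V}) (e f : E) (v : V).

Definition inside X := [set e | ends e \subset node @^-1: X].

(** This is (2,2)-sparsity after contraction of the fibers of [node]; the [+ 2] avoids truncated
    subtraction. Singletons [X] exclude edges of [M] with both ends in one fiber. *)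
Definition sparse M :=
  [forall X : {set N}, (X != set0) ==> (#|M :&: inside X| + 2 <= 2 * #|X|)].

Definition tight M X := (X != set0) && (2 * #|X| <= #|M :&: inside X| + 2).

Lemma ends_ex e : exists v, v \in ends e.
Proof. by apply/set0Pn; rewrite -card_gt0 card_ends. Qed.

Lemma insideP X e : reflect (forall v, v \in ends e -> node v \in X) (e \in inside X).
Proof.
by rewrite inE; apply: (iffP subsetP) => h v /h; rewrite inE.
Qed.

Lemma insideI X Y : inside (X :&: Y) = inside X :&: inside Y.
Proof. by apply/setP=> e; rewrite !inE preimsetI subsetI. Qed.

Lemma insideS X Y : X \subset Y -> inside X \subset inside Y.
Proof. by move=> sXY; apply/subsetP=> e; rewrite !inE => /subset_trans->//; apply: preimsetS. Qed.

Lemma inside_neq0 X e : e \in inside X -> X != set0.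
Proof. by move/insideP=> h; have [v /h] := ends_ex e; case: eqP => // ->; rewrite inE. Qed.

Lemma sparseP M : reflect (forall X, X != set0 -> #|M :&: inside X| + 2 <= 2 * #|X|) (sparse M).
Proof. exact: 'forall_implyP. Qed.

Lemma sparseS M L : L \subset M -> sparse M -> sparse L.
Proof.
move=> sLM /sparseP spM; apply/sparseP=> X /spM; apply: leq_trans.
by rewrite leq_add2r subset_leq_card // setSI.
Qed.

(** An edge inside [X] or inside [Y] is inside the union, and an edge inside both is inside the
    intersection. *)
Lemma inside_supermod M X Y :
  #|M :&: inside X| + #|M :&: inside Y| <=
  #|M :&: inside (X :|: Y)| + #|M :&: inside (X :&: Y)|.
Proof.
rewrite -cardsUI -setIIr insideI leq_add2r subset_leq_card //.
by rewrite -setIUr setIS // subUset !insideS ?subsetUl ?subsetUr.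
Qed.

(** Supermodularity makes the counts for the union and the intersection sum to at least what
    sparsity allows, so both bounds are attained. *)
Lemma tightUI M X Y : sparse M -> tight M X -> tight M Y -> X :&: Y != set0 ->
  tight M (X :|: Y) && tight M (X :&: Y).
Proof.
move=> /sparseP spM /andP[X0 tX] /andP[Y0 tY] XY0.
have XYU0 : X :|: Y != set0.
  by apply: contra_neq X0 => XY; apply/eqP; rewrite -subset0 -XY subsetUl.
have := spM _ XY0; have := spM _ XYU0; have := inside_supermod M X Y.
have := cardsUI X Y; rewrite /tight XY0 XYU0 /=; lia.
Qed.

Lemma tight_eq M X : sparse M -> tight M X -> #|M :&: inside X| + 2 = 2 * #|X|.
Proof. by move=> /sparseP spM /andP[/spM le ge]; apply/eqP; rewrite eqn_leq le. Qed.

Lemma tightU M X Y : sparse M -> tight M X -> tight M Y -> X :&: Y != set0 ->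
  tight M (X :|: Y).
Proof. by move=> spM tX tY /(tightUI spM tX tY)/andP[]. Qed.

(** [L] already has as many edges inside [X] as sparsity allows [M], so [M] has no further ones
    there. *)
Lemma tight_sub M L X : sparse M -> L \subset M -> tight L X ->
  tight M X /\ M :&: inside X = L :&: inside X.
Proof.
move=> /sparseP spM sLM /andP[X0 tX]; have sub := setSI (inside X) sLM.
have := subset_leq_card sub; have := spM _ X0 => h1 h2.
split; first by rewrite /tight X0 /=; lia.
by apply/esym/eqP; rewrite eqEcard sub /=; lia.
Qed.

Lemma tight1 M n : tight M [set n].
Proof.
by rewrite /tight cards1 muln1 leq_addl andbT; apply/set0Pn; exists n; rewrite set11.
Qed.

(** Singletons are tight and tight sets that meet have a tight union; so for sparse [M] this is the
    largest tight set containing [n], and the blocks partition the nodes. *)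
Definition block M n := \bigcup_(X | tight M X && (n \in X)) X.

Lemma mem_block M n : n \in block M n.
Proof. by apply/bigcupP; exists [set n]; rewrite ?tight1 set11. Qed.

Lemma sub_block M X n : tight M X -> n \in X -> X \subset block M n.
Proof. by move=> tX nX; apply: (bigcup_sup X) => //; rewrite tX. Qed.

Lemma tight_block M n : sparse M -> tight M (block M n).
Proof.
move=> spM; rewrite -[block M n](setUidPr (_ : [set n] \subset _)) ?sub1set ?mem_block //.
rewrite /block; elim/big_rec: _ => [|X Y /andP[tX nX] tY]; first by rewrite setU0 tight1.
rewrite setUCA; have XY0 : X :&: (n |: Y) != set0.
  by apply/set0Pn; exists n; rewrite !inE nX eqxx.
by case/andP: (tightUI spM tX tY XY0).
Qed.

Lemma block_eq M n k : sparse M -> n \in block M k -> block M n = block M k.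
Proof.
move=> spM nk; have kn : block M k \subset block M n by rewrite sub_block ?tight_block.
apply/eqP; rewrite eqEsubset kn andbT sub_block ?tight_block //.
exact: (subsetP kn) _ (mem_block _ _).
Qed.

Lemma setU1_inside M e X : e \notin M ->
  #|(e |: M) :&: inside X| = (e \in inside X) + #|M :&: inside X|.
Proof.
move=> eM; rewrite setIUl; case: (boolP (e \in inside X)) => eX.
  by rewrite (setIidPl _) ?sub1set // cardsU1 inE (negPf eM).
suff -> : [set e] :&: inside X = set0 by rewrite set0U.
by apply/setP=> f; rewrite !in_setI !in_set1 in_set0; case: eqP => // ->; rewrite (negPf eX).
Qed.

Lemma sparse_add M e : sparse M -> e \notin M ->
  (forall X, tight M X -> e \notin inside X) -> sparse (e |: M).
Proof.
move=> /sparseP spM eM nt; apply/sparseP=> X X0; have := spM _ X0; have := nt X.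
rewrite /tight X0 setU1_inside //=; case: leqP => [_ /(_ isT)/negPf-> //|lt _ _].
by case: (_ \in inside X) => /=; lia.
Qed.

(** A tight set [Y] of [M :\ f] with [e] inside is tight for [M] too, so it includes the minimal [X]
    and has [f] inside. But by [tight_sub] no edge is lost inside [Y] in passing from [M] to
    [M :\ f]. *)
Lemma sparse_exchange M e f X : sparse M -> e \notin M -> tight M X -> e \in inside X ->
  (forall Y, tight M Y -> e \in inside Y -> #|X| <= #|Y|) ->
  f \in M :&: inside X -> sparse (e |: (M :\ f)).
Proof.
move=> spM eM tX eX minX /setIP[fM fX].
apply: sparse_add; first exact: sparseS (subsetDl _ _) spM.
  by rewrite inE (negPf eM) andbF.
move=> Y tY; apply/negP=> eY.
have [tMY eqY] := tight_sub spM (subsetDl M [set f]) tY.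
have eXY : e \in inside (X :&: Y) by rewrite insideI inE eX.
have /andP[_ tXY] := tightUI spM tX tMY (inside_neq0 eXY).
have /eqP eqXY: X :&: Y == X by rewrite eqEcard subsetIl minX.
have: f \in M :&: inside Y.
  by rewrite inE fM /=; move: fX; rewrite -{1}eqXY insideI inE => /andP[].
by rewrite eqY !inE eqxx.
Qed.

(** For [Y] meeting [Q], compare [Y] and [Q] by supermodularity: the new set has as many edges as
    [M] inside [Y :|: Q], those of [L] inside [Y :&: Q], and [2 * #|Q| - 2] inside [Q]. *)
Lemma sparse_replace M L Q : sparse M -> sparse L -> tight M Q -> tight L Q ->
  sparse ((M :\: inside Q) :|: (L :&: inside Q)).
Proof.
move=> /sparseP spM /sparseP spL /andP[Q0 tM] /andP[_ tL].
set M2 := _ :|: _; apply/sparseP=> Y Y0.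
have [YQ0|YQ0] := eqVneq (Y :&: Q) set0.
  apply: leq_trans (spM _ Y0); rewrite leq_add2r subset_leq_card //.
  apply/subsetP=> f; rewrite !in_setI => /andP[fM2 fY]; rewrite fY andbT.
  move: fM2; rewrite in_setU in_setD in_setI => /orP[/andP[]//|/andP[_ fQ]].
  have : f \in inside (Y :&: Q) by rewrite insideI inE fY.
  by move/inside_neq0; rewrite YQ0 eqxx.
have QI : M2 :&: inside Q = L :&: inside Q.
  apply/setP=> f; rewrite /M2 !(in_setU, in_setI, in_setD).
  by case: (f \in inside Q); rewrite ?andbF ?andbT.
have EI : M2 :&: inside (Y :&: Q) = L :&: inside (Y :&: Q).
  by rewrite insideI [inside Y :&: _]setIC !setIA QI.
have EU : #|M2 :&: inside (Y :|: Q)| = #|M :&: inside (Y :|: Q)|.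
  rewrite -(cardsID (inside Q) (M2 :&: _)) -(cardsID (inside Q) (M :&: _)).
  have sQ : inside Q \subset inside (Y :|: Q) by rewrite insideS ?subsetUr.
  rewrite -!setIA (setIidPr sQ) QI.
  congr (_ + _); last first.
    congr #|pred_of_set _|; apply/setP=> f; rewrite /M2 !(in_setU, in_setI, in_setD).
    by case: (f \in inside Q); rewrite ?andbF ?andbT ?orbF ?andbF.
  by have := spM _ Q0; have := spL _ Q0; lia.
have := inside_supermod M2 Y Q; rewrite EU EI QI.
have YUQ0 : Y :|: Q != set0.
  by apply: contra_neq Y0 => YQ; apply/eqP; rewrite -subset0 -YQ subsetUl.
have := spM _ YUQ0; have := spL _ YQ0; have := cardsUI Y Q; lia.
Qed.

(** * Matchings and saturated vertices *)

Definition matching M := [forall v, #|[set e in M | v \in ends e]| <= 1].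

Lemma matchingP M :
  reflect (forall v, {in M &, forall e f, v \in ends e -> v \in ends f -> e = f}) (matching M).
Proof.
apply: (iffP forallP) => [mM v e f eM fM ve vf|mM v].
  by apply: (card_le1_eqP (mM v)); rewrite inE ?eM ?fM.
by apply/card_le1_eqP=> e f; rewrite !inE => /andP[eM ve] /andP[fM vf]; apply: (mM v).
Qed.

Definition saturated M := \bigcup_(e in M) ends e.

Lemma saturatedP M v : reflect (exists2 e, e \in M & v \in ends e) (v \in saturated M).
Proof. exact: bigcupP. Qed.

Lemma matchingS M L : L \subset M -> matching M -> matching L.
Proof.
move=> sLM /matchingP mM; apply/matchingP=> v e f eL fL; apply: (mM v); exact: (subsetP sLM).
Qed.

Lemma matching_add M e : matching M -> [disjoint ends e & saturated M] -> matching (e |: M).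
Proof.
move=> /matchingP mM dis; have no f v : f \in M -> v \in ends f -> v \in ends e -> False.
  by move=> fM vf ve; have /saturatedP[] := disjointFr dis ve; exists f.
apply/matchingP=> v f g; rewrite !in_setU1.
case/predU1P=> [->|fM] /predU1P[->|gM] // vf vg; last exact: (mM v).
  by case: (no g v).
by case: (no f v).
Qed.

Definition free S := [set e | [disjoint ends e & S]].

Lemma freeS S S' : S \subset S' -> free S' \subset free S.
Proof. by move=> sS; apply/subsetP=> e; rewrite !inE; apply: disjointWr. Qed.

(** * Local search for a largest sparse matching *)

Section LocalSearch.

Variable M : {set E}.
Hypotheses (spM : sparse M) (mM : matching M).
Hypothesis maxM : forall L, sparse L -> matching L -> #|L| <= #|M|.

Definition cell S n := block (M :&: free S) n.

Definition inner S v := inside (cell S (node v)) :&: free S.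

Definition variant D L := [&& sparse L, matching L, #|L| == #|M| & L :\: D == M :\: D].

(** A vertex that is not stuck can be freed by a rearrangement confined to its own cell and to edges
    avoiding [S], so that rearrangements in distinct cells do not interfere. *)
Definition stuck S v := [forall L, variant (inner S v) L ==> (v \in saturated L)].

Definition step S := S :|: [set v | stuck S v].

Lemma sp_free S : sparse (M :&: free S).
Proof. exact: sparseS (subsetIl _ _) spM. Qed.

Lemma tight_cell S n : tight (M :&: free S) (cell S n).
Proof. exact: tight_block (sp_free S). Qed.

Lemma cell_eq S n k : n \in cell S k -> cell S n = cell S k.
Proof. exact: block_eq (sp_free S). Qed.

Lemma variantS D D' L : D \subset D' -> variant D L -> variant D' L.
Proof.
rewrite /variant => sD /and4P[-> -> -> /eqP eqD]; apply/eqP.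
by rewrite -(setUidPr sD) -!setDDl eqD.
Qed.

(** [L] and [M] have equal size and agree outside a subset of [inside X :&: free S], so they have
    equally many edges in that set. *)
Lemma variant_tight D L X S : D \subset inside X :&: free S -> variant D L ->
  tight (L :&: free S) X = tight (M :&: free S) X.
Proof.
move=> sD /and4P[_ _ /eqP cL /eqP eqD]; rewrite /tight -!setIA [free S :&: _]setIC.
by rewrite (card_setI_exchange cL eqD sD).
Qed.

Lemma variant_inner_tight S v L : variant (inner S v) L -> tight L (cell S (node v)).
Proof.
move=> vL; have spL : sparse L by case/and4P: vL.
have t : tight (L :&: free S) (cell S (node v)).
  by rewrite (variant_tight (subxx _) vL) tight_cell.
by have [] := tight_sub spL (subsetIl _ _) t.
Qed.

Lemma variant_out D L f : variant D L -> f \notin D -> (f \in L) = (f \in M).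
Proof. by case/and4P=> _ _ _ /eqP/setP/(_ f); rewrite !inE => + /negPf fD; rewrite fD. Qed.


Lemma unstuck S v : ~~ stuck S v -> exists2 L, variant (inner S v) L & v \notin saturated L.
Proof. by rewrite negb_forall => /existsP[L]; rewrite negb_imply => /andP[]; exists L. Qed.

(* The two variants change [M] only inside disjoint cells, hence can be superposed. *)
Lemma combine_variants S e x y : ends e = [set x; y] ->
  node y \notin cell S (node x) -> ~~ stuck S x -> ~~ stuck S y ->
  exists L, [/\ variant (inner S x :|: inner S y) L, [disjoint ends e & saturated L]
              & forall X, tight (L :&: free S) X -> e \notin inside X].
Proof.
move=> exy yx /unstuck[Lx vx x_Lx] /unstuck[Ly vy y_Ly].
set Qx := cell S (node x) in yx; set Qy := cell S (node y).
have disQ n : n \in Qx -> n \in Qy -> False.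
  move=> /cell_eq nx /cell_eq ny; move: yx.
  by rewrite /Qx -nx ny mem_block.
have [spx mx /eqP cx _] := and4P vx; have [spy my /eqP cy _] := and4P vy.
have outx f : f \notin inside Qx -> (f \in Lx) = (f \in M).
  by move=> fQ; rewrite (variant_out vx) // inE negb_and fQ.
have outy f : f \notin inside Qy -> (f \in Ly) = (f \in M).
  by move=> fQ; rewrite (variant_out vy) // inE negb_and fQ.
have endy f v : v \in ends f -> node v \in Qy -> f \notin inside Qx.
  by move=> vf vQ; apply/negP=> /insideP/(_ _ vf)/disQ; apply.
have dis f : f \in inside Qy -> f \notin inside Qx.
  by move=> fQ; have [v vf] := ends_ex f; apply: (endy _ v vf); apply: (insideP _ _ fQ).
(* The cells are disjoint: [L] follows [Lx] inside [Qx], [Ly] inside [Qy], and [M] elsewhere. *)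
pose L := (Lx :\: inside Qy) :|: (Ly :&: inside Qy).
have LE f : (f \in L) = if f \in inside Qy then f \in Ly else f \in Lx.
  by rewrite !(in_setU, in_setI, in_setD); case: (f \in inside Qy); rewrite ?andbF ?andbT ?orbF.
have MxQ : Lx :&: inside Qy = M :&: inside Qy.
  apply/setP=> f; rewrite !in_setI; case: (boolP (f \in inside Qy)); rewrite ?andbF // => /dis fQ.
  by rewrite outx.
have ty : tight Ly Qy := variant_inner_tight vy.
have tx : tight Lx Qx := variant_inner_tight vx.
have tMy : tight M Qy by have [] := tight_sub spM (subsetIl _ _) (tight_cell S (node y)).
have txy : tight Lx Qy by move: tMy; rewrite /tight MxQ.
have spL : sparse L := sparse_replace spx spy txy ty.
(* An edge with an end in [Qy] is not inside [Qx]; unless it is inside [Qy], the sets [Lx], [M] and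
   [Ly] agree on it. So at each vertex the edges of [L] all come from one of the matchings [Lx] and
   [Ly]. *)
have Ly_of f v : f \in L -> v \in ends f -> node v \in Qy -> f \in Ly.
  rewrite LE; case: ifP => // /negbT fQy fLx vf vQ.
  by rewrite outy // -outx //; apply: endy vQ.
have Lx_of f v : f \in L -> v \in ends f -> node v \notin Qy -> f \in Lx.
  by rewrite LE; case: ifP => // /insideP fQy _ /fQy ->.
have mL : matching L.
  apply/matchingP=> v f g fL gL vf vg.
  case: (boolP (node v \in Qy)) => vQ.
    by apply: (matchingP _ my v) => //; [apply: Ly_of vf vQ|apply: Ly_of vg vQ].
  by apply: (matchingP _ mx v) => //; [apply: Lx_of vf vQ|apply: Lx_of vg vQ].
(* [L] and [Lx] differ only inside [Qy], which is tight for [Lx] and [Ly]. *)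
have cL : #|L| = #|M|.
  rewrite -(cardsID (inside Qy) L) -cx -(cardsID (inside Qy) Lx).
  have -> : L :\: inside Qy = Lx :\: inside Qy.
    by apply/setP=> f; rewrite !in_setD LE; case: ifP.
  have -> : L :&: inside Qy = Ly :&: inside Qy.
    by apply/setP=> f; rewrite !in_setI LE; case: ifP; rewrite ?andbF.
  by congr (_ + _); apply: (@addIn 2); rewrite !tight_eq.
have vL : variant (inner S x :|: inner S y) L.
  rewrite /variant spL mL cL eqxx /=; apply/eqP/setP=> f.
  rewrite in_setD [RHS]in_setD in_setU; case: norP => //= -[fx fy].
  by rewrite LE (variant_out vx fx) (variant_out vy fy) if_same.
exists L; split=> //.
  rewrite exy disjoints_subset subUset !sub1set !inE; apply/andP; split.
    apply/negP=> /saturatedP[f fL xf]; case/negP: x_Lx; apply/saturatedP; exists f => //.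
    by apply: (Lx_of _ x) => //; apply/negP=> /disQ; apply; apply: mem_block.
  apply/negP=> /saturatedP[f fL yf]; case/negP: y_Ly; apply/saturatedP; exists f => //.
  by apply: (Ly_of _ y) => //; apply: mem_block.
move=> X tX; apply/negP=> /insideP eX.
have xX : node x \in X by apply: eX; rewrite exy !inE eqxx.
have yX : node y \in X by apply: eX; rewrite exy !inE eqxx orbT.
have spLS : sparse (L :&: free S) := sparseS (subsetIl _ _) spL.
have tLx : tight (L :&: free S) Qx.
  have := variant_tight (subxx _) vx; rewrite -/Qx tight_cell /tight.
  suff -> : L :&: free S :&: inside Qx = Lx :&: free S :&: inside Qx by [].
  apply/setP=> f; rewrite !in_setI; case: (boolP (f \in inside Qx)); rewrite ?andbF // => fQ.
  by rewrite LE; case: ifP => // /dis; rewrite fQ.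
have tLy : tight (L :&: free S) Qy.
  have := variant_tight (subxx _) vy; rewrite -/Qy tight_cell /tight.
  suff -> : L :&: free S :&: inside Qy = Ly :&: free S :&: inside Qy by [].
  apply/setP=> f; rewrite !in_setI; case: (boolP (f \in inside Qy)); rewrite ?andbF // => fQ.
  by rewrite LE fQ.
(* A tight set with [e] inside would merge with both cells. All changes are inside [Y], so [Y] would
   be tight for [M :&: free S] as well and place [y] in the cell of [x]. *)
pose Y := X :|: Qx :|: Qy.
have tLY : tight (L :&: free S) Y.
  apply: tightU => //; first apply: tightU => //.
    by apply/set0Pn; exists (node x); rewrite inE xX mem_block.
  by apply/set0Pn; exists (node y); rewrite !inE yX mem_block.
have sD : inner S x :|: inner S y \subset inside Y :&: free S.
  rewrite subUset !setSI // insideS // /Y; first by rewrite subsetUr.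
  by rewrite -setUA setUCA subsetUl.
have tMY : tight (M :&: free S) Y by rewrite -(variant_tight sD vL).
case/negP: yx; apply: (subsetP (sub_block tMY _)); rewrite !inE ?xX ?yX //.
Qed.

Lemma step_sub S : S \subset step S.
Proof. exact: subsetUl. Qed.

Lemma cell_sub S S' n : S \subset S' -> cell S' n \subset cell S n.
Proof.
move=> sS; have [|t _] := tight_sub (sp_free S) _ (tight_cell S' n).
  by rewrite setIS ?freeS.
by rewrite sub_block ?mem_block.
Qed.

(* Take a least [k] violating this. Once both ends of [e] are freed, adding [e] either enlarges
   [M] (when [k = 0]) or, in exchange for an edge at a vertex [u] added to the set in the last
   step, frees [u], which was stuck. *)
Lemma reached_same_cell k e x y : e \notin M -> ends e = [set x; y] ->
  [disjoint ends e & iter k.+1 step set0] ->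
  node y \in cell (iter k step set0) (node x).
Proof.
elim: k => [|k IH] eM exy; rewrite iterS; last rewrite iterS in IH.
all: set S := iter _ _ _ => dis; apply: contraT => yx.
all: have [xe ye] : x \in ends e /\ y \in ends e by rewrite exy !inE !eqxx orbT.
all: have [L [vL disL nt]] : exists L, [/\ variant (inner S x :|: inner S y) L,
  [disjoint ends e & saturated L] & forall X, tight (L :&: free S) X -> e \notin inside X]
  by apply: combine_variants => //; [move: (disjointFr dis xe)|move: (disjointFr dis ye)];
     rewrite !inE => /norP[].
all: have [spL mL /eqP cL _] := and4P vL.
all: have eL : e \notin L by apply/negP=> eL; move: (disjointFr disL xe);
  move/negP; apply; apply/saturatedP; exists e.
  have free0 : free S = setT.
    by apply/setP=> f; rewrite !inE disjoint_sym disjoints_subset sub0set.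
  have := maxM (sparse_add spL eL _) (matching_add mL disL).
  rewrite cardsU1 eL cL add1n ltnn; apply=> X tX; apply: nt.
  by rewrite free0 setIT.
pose S' := iter k step set0; have SE : S = step S' by [].
have disS : [disjoint ends e & S] by apply: disjointWr (step_sub _) dis.
have := IH eM exy disS; rewrite -/S'; set Q := cell S' (node x) => yQ.
have eQ : e \in inside Q.
  by apply/insideP=> v; rewrite exy !inE => /orP[]/eqP-> //; apply: mem_block.
have sQ n : n \in Q -> cell S n \subset Q.
  by move=> nQ; rewrite /Q -(cell_eq nQ) cell_sub // SE step_sub.
have sD v : node v \in Q -> inner S v \subset inside Q :&: free S'.
  by move=> vQ; rewrite setISS ?insideS ?sQ // freeS // SE step_sub.
have sDxy : inner S x :|: inner S y \subset inside Q :&: free S'.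
  by rewrite subUset !sD ?mem_block.
have vL' := variantS sDxy vL.
have [tLQ EQ] : tight L Q /\ L :&: inside Q = L :&: free S' :&: inside Q.
  by apply: tight_sub => //; rewrite ?subsetIl // (variant_tight (subxx _) vL') tight_cell.
have [X /andP[tX eX] minX] : exists2 X, tight L X && (e \in inside X) &
    forall Y, tight L Y && (e \in inside Y) -> #|X| <= #|Y|.
  pose P := [pred X | tight L X && (e \in inside X)].
  have PQ : P Q by rewrite /= tLQ.
  by case: (@arg_minnP _ Q P (fun X : {set N} => #|X|) PQ) => X; exists X.
have XQ : X \subset Q.
  have eXQ : e \in inside (X :&: Q) by rewrite insideI inE eX.
  have /andP[_ tXQ] := tightUI spL tX tLQ (inside_neq0 eXQ).
  have /eqP <- : X :&: Q == X by rewrite eqEcard subsetIl minX // tXQ.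
  exact: subsetIr.
(* No tight set of [L :&: free S] has [e] inside, so [X] owes its tightness to an edge [f] of [L]
   that meets [S]. *)
have [f fLX fS] : exists2 f, f \in L :&: inside X & f \notin free S.
  apply/subsetPn; apply: contraL eX => sub; apply: nt.
  by move: tX; rewrite /tight setIAC (setIidPl sub).
have [fL fX] := setIP fLX.
have fQ : f \in inside Q by apply: subsetP fX; apply: insideS.
have fS' : f \in free S'.
  have : f \in L :&: inside Q by rewrite inE fL.
  by rewrite EQ !in_setI => /andP[/andP[]].
have [u uf uS] : exists2 u, u \in ends f & u \in S.
  by move: fS; rewrite inE => /pred0Pn[u /andP[]]; exists u.
have uQ : node u \in Q by apply: (insideP _ _ fQ).
(* Inside [Q] the edges of [L] avoid [S'], so the end [u] of [f] entered [S] in the last step. *)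
have su : stuck S' u.
  move: uS; rewrite SE !inE => /orP[uS'|//].
  by move: fS'; rewrite inE => /(disjointFr)/(_ uf); rewrite uS'.
have ef : e != f by apply: contraNneq eL => ->.
pose L3 := e |: (L :\ f).
have eLf : e \notin L :\ f by rewrite inE negb_and eL orbT.
have v3 : variant (inner S' u) L3.
  apply/and4P; split.
  - by apply: sparse_exchange tX eX _ fLX => // Y tY eY; apply: minX; rewrite tY.
  - apply: matching_add; first exact: matchingS (subsetDl _ _) mL.
    apply: disjointWr disL; apply/subsetP=> v /saturatedP[g /setD1P[_ gL] vg].
    by apply/saturatedP; exists g.
  - by rewrite cardsU1 eLf -cL (cardsD1 f L) fL.
  - have DE : inner S' u = inside Q :&: free S' by rewrite /inner (cell_eq uQ).
    have eD : e \in inside Q :&: free S'.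
      by rewrite inE eQ inE; apply: disjointWr disS; rewrite SE step_sub.
    have fD : f \in inside Q :&: free S' by rewrite inE fQ.
    rewrite DE; have /and4P[_ _ _ /eqP <-] := vL'; apply/eqP/setP=> g.
    rewrite in_setD [RHS]in_setD in_setU1 in_setD1; case: (boolP (g \in _)) => //= gD.
    have -> : (g == e) = false by apply: contraNF gD => /eqP->.
    by have -> : (g == f) = false by apply: contraNF gD => /eqP->.
have /implyP/(_ v3)/saturatedP[g] := forallP su L3.
rewrite in_setU1 in_setD1 => /orP[/eqP->|/andP[gf gL]] ug.
  by rewrite (disjointFr disS ug) in uS.
by case/eqP: gf; apply: (matchingP _ mL u).
Qed.

(** [M] is a variant of itself, so it saturates every stuck vertex. *)
Lemma reached_saturated k : iter k step set0 \subset saturated M.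
Proof.
elim: k => [|k IH]; first by rewrite sub0set.
rewrite iterS subUset IH; apply/subsetP=> v; rewrite inE => /forallP/(_ M)/implyP; apply.
by rewrite /variant spM mM !eqxx.
Qed.

(** At a fixed point of [step], the two consecutive sets in [reached_same_cell] coincide. *)
Lemma obstruction : exists2 S : {set V}, S \subset saturated M &
  forall e x y, e \notin M -> ends e = [set x; y] -> [disjoint ends e & S] ->
    node y \in block (M :&: free S) (node x).
Proof.
have [k fixk] := inflationary_fixpoint step_sub.
exists (iter k step set0); first exact: reached_saturated.
by move=> e x y eM exy dis; apply: (reached_same_cell eM exy); rewrite iterS fixk.
Qed.

End LocalSearch.

(** * Existence of a tight matching *)

Definition end_of e := xchoose (ends_ex e).

Lemma end_ofP e : end_of e \in ends e.
Proof. exact: xchooseP. Qed.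

Definition blocks L := [set block L n | n : N].

(** For sparse [L] the blocks are a partition, so looking at the block of one chosen end
    suffices. *)
Definition crossing L := [set e in L | e \notin inside (block L (node (end_of e)))].

(** Each block [Q] has exactly [2 * #|Q| - 2] edges of [L] inside; summing over the partition counts
    the edges of [L] that do not cross. *)
Lemma card_sparse_blocks L : sparse L ->
  #|L| + 2 * #|blocks L| = 2 * #|N| + #|crossing L|.
Proof.
move=> spL; have Pn n : block L n \in blocks L by apply: imset_f.
have blE Q n : Q \in blocks L -> (block L n == Q) = (n \in Q).
  case/imsetP=> k _ ->; apply/eqP/idP=> [<-|]; first exact: mem_block.
  exact: block_eq.
have -> : #|N| = \sum_(Q in blocks L) #|Q|.
  rewrite -sum1_card (partition_big (block L) (mem (blocks L))) //=.
  by apply: eq_bigr => Q PQ; rewrite -sum1_card; apply: eq_bigl => n; rewrite blE.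
have -> : #|L| = #|crossing L| + \sum_(Q in blocks L) #|L :&: inside Q|.
  rewrite -(cardsID (crossing L) L) (setIidPr _); last by apply/subsetP=> e; rewrite inE => /andP[].
  congr (_ + _); rewrite -sum1_card.
  rewrite (partition_big (fun e => block L (node (end_of e))) (mem (blocks L))) //=.
  apply: eq_bigr => Q PQ; rewrite -sum1_card; apply: eq_bigl => e.
  rewrite blE // in_setD in_setI /crossing inE.
  case: (boolP (node (end_of e) \in Q)) => [eQ|eQ].
    have /eqP -> : block L (node (end_of e)) == Q by rewrite blE.
    case: (e \in L); case: (e \in inside Q) => //=.
  rewrite andbF; case: (boolP (e \in inside Q)) => [/insideP/(_ _ (end_ofP e))|].
    by rewrite (negPf eQ).
  by rewrite andbF.
rewrite -addnA addnC; congr (_ + _); rewrite mulnC big_distrr /= -sum_nat_const -big_split /=.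
by apply: eq_bigr => Q /imsetP[n _ ->]; rewrite (tight_eq spL) ?tight_block.
Qed.

(** An edge of [D] covers at most one vertex of [S], or two if both of its ends lie in [S]. *)
Lemma matching_cover_card M S D : S \subset \bigcup_(e in D) ends e -> D \subset M ->
  #|S| <= #|D| + #|[set e in M | ends e \subset S]|.
Proof.
move=> sSD sDM.
have sub : S \subset \bigcup_(e in D) (ends e :&: S).
  apply/subsetP=> v vS; have /bigcupP[e eD ve] := subsetP sSD _ vS.
  by apply/bigcupP; exists e => //; rewrite inE ve.
apply: leq_trans (subset_leq_card sub) _; apply: leq_trans (bigcup_card_le _ _) _.
apply: (@leq_trans (\sum_(e in D) (1 + (ends e \subset S)))).
  apply: leq_sum => e _; case: (boolP (ends e \subset S)) => eS.
    by have := subset_leq_card (subsetIl (ends e) S); rewrite card_ends.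
  rewrite addn0 -ltnS -(card_ends e) proper_card // properEneq subsetIl andbT.
  by apply: contraNneq eS => <-; apply: subsetIr.
rewrite big_split /= sum1_card leq_add2l -big_mkcondr /= sum1_card.
by apply: subset_leq_card; apply/subsetP=> e; rewrite !inE => /andP[/(subsetP sDM)-> ->].
Qed.

(** Toughness enters through labelings [p] constant along the edges avoiding [U]: the number of
    labels outside [U] is a lower bound for the number of components. *)
Lemma exists_sparse_matching :
  (forall n, 5 <= #|node @^-1: [set n]|) ->
  (forall (U : {set V}) (p : V -> {set N}),
     (forall e x y, ends e = [set x; y] -> [disjoint ends e & U] -> p x = p y) ->
     #|p @: (~: U)| <= 1 \/ 16 * #|p @: (~: U)| <= #|U|) ->
  0 < #|N| ->
  exists M, [/\ sparse M, matching M & #|M| + 2 = 2 * #|N|].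
Proof.
move=> fiber5 toughness N_gt0.
have ok0 : sparse set0 && matching set0.
  apply/andP; split; last by apply/matchingP=> v e f; rewrite inE.
  apply/sparseP=> X X0; rewrite set0I cards0 add0n.
  by rewrite -[2]muln1 leq_pmul2l // card_gt0.
have [M /andP[spM mM] maxM] : exists2 M, sparse M && matching M &
    forall L, sparse L && matching L -> #|L| <= #|M|.
  by case: (@arg_maxnP _ set0 [pred M | sparse M && matching M] (fun M => #|M|) ok0) => M; exists M.
have {}maxM L : sparse L -> matching L -> #|L| <= #|M| by move=> spL mL; rewrite maxM ?spL.
exists M; split=> //; apply/eqP; rewrite eqn_leq.
have T0 : [set: N] != set0 by rewrite -card_gt0 cardsT.
have -> /= : #|M| + 2 <= 2 * #|N|.
  have := sparseP _ spM _ T0; rewrite cardsT (setIidPl _) //.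
  by apply/subsetP=> e _; apply/insideP=> v; rewrite inE.
rewrite leqNgt; apply/negP=> small.
have [S satS same] := obstruction spM mM maxM.
pose L := M :&: free S; have spL : sparse L := sparseS (subsetIl _ _) spM.
pose T := [set end_of e | e in crossing L]; pose U := S :|: T.
pose p v := block L (node v).
(* An edge avoiding [U] is either outside [M], where [same] applies, or in [L]; in the latter case
   it does not cross, since [T] contains an end of each crossing edge. *)
have pE e x y : ends e = [set x; y] -> [disjoint ends e & U] -> p x = p y.
  move=> exy disU; have disS : [disjoint ends e & S] by apply: disjointWr disU; apply: subsetUl.
  case: (boolP (e \in M)) => [eM|eM]; last by rewrite [RHS](block_eq spL (same e x y eM exy disS)).
  have eL : e \in L by rewrite inE eM inE.
  have /insideP eI : e \in inside (block L (node (end_of e))).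
    apply: contraT => eC; have /negP[] := disjointFr disU (end_ofP e).
    by rewrite inE [in X in _ || X]imset_f ?orbT // inE eL.
  by rewrite /p !(block_eq spL (eI _ _)) ?exy ?set21 ?set22.
have tU := toughness U p pE; set q1 := #|_| in tU.
(* [P0] consists of the blocks that are covered by [U]. *)
pose P0 := blocks L :\: p @: (~: U); pose N0 := [set n | block L n \in P0].
pose W0 := node @^-1: N0; pose S0 := S :&: W0.
have q0_le : #|P0| <= #|N0|.
  apply: leq_trans (leq_imset_card (block L) _); apply/subset_leq_card/subsetP=> Q QP.
  by have /setDP[/imsetP[n _ QE] _] := QP; rewrite QE imset_f // inE -QE.
have q_le : #|blocks L| <= #|P0| + q1.
  by rewrite -(cardsID (p @: (~: U)) (blocks L)) addnC leq_add2l subset_leq_card ?subsetIr.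
have W0U : W0 \subset U.
  apply/subsetP=> v; rewrite !in_set => /andP[+ _]; apply: contraNT => vU.
  by apply/imsetP; exists v; rewrite // !in_set.
have W0_ge : 5 * #|N0| <= #|W0|.
  rewrite -[#|W0|]sum1_card (partition_big node (mem N0)) /=; last by move=> v; rewrite inE.
  rewrite mulnC -sum_nat_const; apply: leq_sum => n nN0; rewrite sum1_card.
  apply: leq_trans (fiber5 n) _; apply/subset_leq_card/subsetP=> v; rewrite !inE => /eqP vn.
  by rewrite unfold_in /= inE vn nN0 eqxx.
have T_le : #|T| <= #|crossing L| by apply: leq_imset_card.
have W0_le : #|W0| <= #|S0| + #|T|.
  apply: leq_trans (subset_leq_card _) (leq_card_setU _ _); apply/subsetP=> v vW.
  by have := subsetP W0U _ vW; rewrite !in_setU in_setI vW andbT.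
pose D := M :\: free S.
have SD : S \subset \bigcup_(e in D) ends e.
  apply/subsetP=> v vS; have /saturatedP[e eM ve] := subsetP satS _ vS.
  apply/bigcupP; exists e => //; rewrite inE eM inE andbT.
  by apply/pred0Pn; exists v; rewrite /= ve.
have DM : D \subset M := subsetDl _ _.
have MI_le : #|M :&: inside N0| <= 2 * #|N0|.
  have [->|N0_neq0] := eqVneq N0 set0; last first.
    exact: leq_trans (leq_addr _ _) (sparseP _ spM _ N0_neq0).
  rewrite cards0 muln0 leqn0 cards_eq0; apply/eqP/setP=> e; rewrite !in_setI in_set0.
  by apply/negP=> /andP[_ /inside_neq0]; rewrite eqxx.
have s0_le : #|S0| <= #|D| + 2 * #|N0|.
  apply: leq_trans (matching_cover_card (subset_trans (subsetIl _ _) SD) DM) _.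
  rewrite leq_add2l; apply: leq_trans MI_le; apply/subset_leq_card/subsetP=> e.
  rewrite !inE => /andP[-> /subset_trans]; apply; exact: subsetIr.
have s_le : #|S| <= 2 * #|D|.
  apply: leq_trans (matching_cover_card SD DM) _; rewrite mul2n -addnn leq_add2l.
  apply/subset_leq_card/subsetP=> e; rewrite !inE => /andP[-> eS]; rewrite andbT.
  by apply/pred0Pn; exists (end_of e); rewrite /= (subsetP eS) ?end_ofP.
have cM := cardsID (free S) M; rewrite -/L -/D in cM.
have cL := card_sparse_blocks spL.
have s0s : #|S0| <= #|S| by rewrite subset_leq_card ?subsetIl.
have U_le : #|U| <= #|S| + #|T| by apply: leq_card_setU.
(* Put [c = #|crossing L|] and [d = #|D|]. The bounds give [c + d + 3 <= 2 * #|blocks L|] and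
   [3 * #|P0| <= c + d], hence [c + d + 9 <= 6 * q1]. So [q1] is at least 2 and [16 * q1] exceeds
   [2 * d + c], which is at least [#|U|]. *)
move: small tU q0_le q_le W0_ge T_le W0_le s0_le s_le cM cL s0s U_le.
clear; move: #|M| #|L| #|D| #|N| #|crossing L| #|blocks L| #|P0|.
by move: q1 #|N0| #|W0| #|S0| #|S| #|T| #|U|; lia.
Qed.

(** By sparsity the two sides together hold at most [2 * #|N| - 4] edges of [M]. *)
Lemma two_crossing M X : sparse M -> #|M| + 2 = 2 * #|N| -> X != set0 -> ~: X != set0 ->
  2 <= #|M :\: (inside X :|: inside (~: X))|.
Proof.
move=> /sparseP spM cM X0 XC0; have := spM _ X0; have := spM _ XC0; have := cardsC X.
have := cardsID (inside X :|: inside (~: X)) M; rewrite setIUr => cI.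
have /leqifP := leq_card_setU (M :&: inside X) (M :&: inside (~: X)).
by move: cM cI; clear; case: ifP => _; lia.
Qed.

Lemma handshake D (W : {set V}) :
  \sum_(v in W) #|[set e in D | v \in ends e]| = \sum_(e in D) #|ends e :&: W|.
Proof.
transitivity (\sum_(v in W) \sum_(e in D) (v \in ends e : nat)).
  apply: eq_bigr => v _; rewrite -big_mkcondr /= sum1_card.
  by apply: eq_card => e; rewrite inE.
rewrite exchange_big; apply: eq_bigr => e _; rewrite -big_mkcondr /= sum1_card.
by apply: eq_card => v; rewrite inE andbC.
Qed.

End Sparsity.

(** * Short cycles and components *)

Section Graph.

Variable G : mgraph.
Implicit Types (S W : {set vertex G}) (F H : {set edge G}) (u v w x y : vertex G) (e f : edge G).

Lemma ends_eq e x y : x != y -> x \in ends e -> y \in ends e -> ends e = [set x; y].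
Proof.
move=> xy xe ye; apply/esym/eqP; rewrite eqEcard subUset !sub1set xe ye.
by rewrite cards2 xy card_ends.
Qed.

Lemma endsE e : exists x y, x != y /\ ends e = [set x; y].
Proof. by have /eqP/cards2P[x [y [xy E]]] := card_ends e; exists x, y. Qed.

Lemma adj_minusP S x y :
  reflect [/\ x \notin S, y \notin S & exists e, ends e = [set x; y]] (adj_minus S x y).
Proof.
apply: (iffP and3P) => -[xS yS]; first by case/existsP=> e /eqP; split=> //; exists e.
by case=> e E; split=> //; apply/existsP; exists e; apply/eqP.
Qed.

Lemma connect_adj_sym S : connect_sym (adj_minus S).
Proof. by apply: sym_connect_sym => x y; rewrite /adj_minus /= setUC andbCA. Qed.

Lemma adj_closed S : closed (adj_minus S) (~: S).
Proof. by move=> x y /adj_minusP[xS yS _]; rewrite !inE xS yS. Qed.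

(** Labels are constant on components, so every label that occurs is the label of a component's
    root. *)
Lemma omega_ge (T : finType) S (p : vertex G -> T) :
  (forall e x y, ends e = [set x; y] -> [disjoint ends e & S] -> p x = p y) ->
  #|p @: (~: S)| <= omega_minus S.
Proof.
move=> pE; rewrite /omega_minus.
have pc x y : connect (adj_minus S) x y -> p x = p y.
  case/connectP=> s + ->; elim: s x => //= z s IH x /andP[/adj_minusP[xS zS [e E]] /IH <-].
  by apply: (pE e) => //; rewrite E disjoints_subset subUset !sub1set !inE xS zS.
apply: leq_trans (leq_imset_card p _); apply/subset_leq_card/subsetP=> _ /imsetP[x xS ->].
apply/imsetP; exists (fingraph.root (adj_minus S) x); last exact/pc/connect_root.
rewrite inE /= (roots_root (@connect_adj_sym S)).
by rewrite -(closed_connect (@adj_closed S) (connect_root _ x)).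
Qed.

Lemma omega_le1 S :
  (forall x y, x \notin S -> y \notin S -> connect (adj_minus S) x y) -> omega_minus S <= 1.
Proof.
move=> conn; apply/card_le1_eqP=> x y; rewrite !inE => /andP[/eqP rx xS] /andP[/eqP ry yS].
by rewrite -rx -ry; apply/fingraph.rootP; [apply: connect_adj_sym | apply: conn].
Qed.

(** A closed stretch of a walk without immediate reuse of an edge is a cycle if its vertices are
    distinct; otherwise it contains a shorter closed stretch. *)
Lemma cycle_of_walk (v : nat -> vertex G) (e : nat -> edge G) i d :
  (forall j, ends (e j) = [set v j; v j.+1]) -> (forall j, e j.+1 != e j) ->
  0 < d -> v i = v (i + d) -> exists2 k, k <= d & has_cycle G k.
Proof.
move=> endv nb; elim/ltn_ind: d i => d IH i d_gt0 vid.
case: (boolP [forall a : 'I_d, forall b : 'I_d, (v (i + a) == v (i + b)) ==> (a == b)]); last first.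
  rewrite negb_forall => /existsP[a]; rewrite negb_forall => /existsP[b].
  rewrite negb_imply => /andP[/eqP vab ab].
  wlog lt_ab : a b vab ab / a < b.
    move: (ab); rewrite neq_ltn => /orP[lt|lt] gen; first exact: (gen a b).
    by apply: (gen b a); rewrite // eq_sym.
  have [| | |k le_k cyc] := IH (b - a) _ (i + a).
  - by apply: leq_ltn_trans (leq_subr _ _) _.
  - by rewrite subn_gt0.
  - by rewrite -addnA subnKC // ltnW.
  exists k => //; apply: leq_trans le_k _; apply: leq_trans (leq_subr _ _) _; exact: ltnW.
move=> injb; have injv (a b : 'I_d) : v (i + a) = v (i + b) -> a = b.
  by move=> E; apply/eqP; move/forallP/(_ a)/forallP/(_ b)/implyP: injb; apply; apply/eqP.
exists d => //; have d_gt1 : 1 < d.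
  case: d vid d_gt0 {IH injb injv} => [|[|d]] // vid _.
  by have := card_ends (e i); rewrite endv -[i.+1]addn1 -vid setUid cards1.
split=> //; exists (fun a : 'I_d => v (i + a)), (fun a : 'I_d => e (i + a)).
split=> [a b /injv // | a b eab | a]; last first.
  rewrite endv /=; have := ltn_ord a; rewrite leq_eqVlt => /predU1P[aE|lt]; last first.
    by rewrite modn_small // addnS.
  by rewrite -addnS aE modnn addn0 vid.
apply/eqP; apply/contraT; move=> ab.
wlog lt_ab : a b eab ab / a < b.
  move: (ab); rewrite neq_ltn => /orP[lt|lt] gen; first exact: (gen a b).
  by apply: (gen b a); rewrite // eq_sym.
(* If the edges at [a < b] coincide, the vertex at [b] is an end of the edge at [a], which forces
   [b = a + 1]; but consecutive edges differ. *)
have : v (i + b) \in ends (e (i + a)) by rewrite eab endv set21.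
rewrite endv !inE => /orP[/eqP/injv ba|]; first by rewrite ba eqxx in ab.
rewrite -addnS => /eqP E; have lt_a1 : a.+1 < d by apply: leq_ltn_trans (ltn_ord b).
have /(congr1 val) /= bE := injv b (Ordinal lt_a1) E.
by case/eqP: (nb (i + a)); rewrite eab bE addnS.
Qed.

(** Walk on, leaving each vertex by the edge other than the one of arrival. The walk stays in the
    component, so by the pigeonhole principle it repeats a vertex within as many steps as the
    component has vertices. *)
Lemma cycle_in_component x :
  (forall u, degree u = 2) ->
  exists2 k, k <= #|[set u | connect (adj_minus set0) x u]| & has_cycle G k.
Proof.
move=> deg2.
pose nxt (t : vertex G * edge G) :=
  let w := odflt t.1 [pick w in ends t.2 :\ t.1] in
  (w, odflt t.2 [pick e | (w \in ends e) && (e != t.2)]).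
have nxtP t : t.1 \in ends t.2 ->
    [/\ ends t.2 = [set t.1; (nxt t).1], (nxt t).1 \in ends (nxt t).2 & (nxt t).2 != t.2].
  case: t => u e /= ue; case: pickP => [w /setD1P[wu we]|no] /=; last first.
    have := cardsD1 u (ends e); rewrite card_ends ue (eq_card0 (A := _ :\ _)) //.
  split; first by apply: ends_eq; rewrite // eq_sym.
    by case: pickP => [e' /andP[]|].
  case: pickP => [e' /andP[]|no] //=.
  have := cardsD1 e [set f | w \in ends f]; rewrite -/(degree w) deg2 inE we.
  by rewrite eq_card0 // => f; have := no f; rewrite !inE andbC.
have [e0 xe0] : exists e0, x \in ends e0.
  have /card_gt0P[e0] : 0 < degree x by rewrite deg2.
  by rewrite inE; exists e0.
pose st n := iter n nxt (x, e0).
have st_in n : (st n).1 \in ends (st n).2.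
  by elim: n => [|n IH] //=; have [] := nxtP _ IH.
have endv n : ends (st n).2 = [set (st n).1; (st n.+1).1] by have [] := nxtP _ (st_in n).
have nb n : (st n.+1).2 != (st n).2 by have [] := nxtP _ (st_in n).
set C := [set _ | _]; have inC n : (st n).1 \in C.
  elim: n => [|n IH]; first by rewrite inE connect0.
  rewrite inE; move: IH; rewrite inE => /connect_trans; apply; apply: connect1.
  by apply/adj_minusP; rewrite !inE; split=> //; exists (st n).2.
have [a [b [ab vab]]] : exists a b : 'I_#|C|.+1, a != b /\ (st a).1 = (st b).1.
  have : ~~ injectiveb (fun a : 'I_#|C|.+1 => (st a).1).
    apply/negP=> /injectiveP inj; have := card_imset 'I_#|C|.+1 inj.
    have : (fun a : 'I_#|C|.+1 => (st a).1) @: 'I_#|C|.+1 \subset C.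
      by apply/subsetP=> _ /imsetP[a _ ->].
    by move/subset_leq_card => + E; rewrite E card_ord ltnn.
  by case/injectivePn=> a [b ab E]; exists a, b.
wlog lt_ab : a b ab vab / a < b.
  move: (ab); rewrite neq_ltn => /orP[lt|lt] gen; first exact: (gen a b).
  by apply: (gen b a); rewrite // eq_sym.
have [| |k le_k cyc] := @cycle_of_walk (fun n => (st n).1) (fun n => (st n).2) a (b - a) endv nb.
- by rewrite subn_gt0.
- by rewrite subnKC // ltnW.
by exists k => //; apply: leq_trans le_k _; apply: leq_trans (leq_subr _ _) (leq_ord _).
Qed.

Lemma tough16_nat (R : realType) S :
  tough (16%:R : R)%R G -> omega_minus S <= 1 \/ 16 * omega_minus S <= #|S|.
Proof.
move=> /(_ S); rewrite Order.TotalTheory.le_max => /orP[].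
  by rewrite -[1%R]/(1%:R)%R Num.Theory.ler_nat; left.
rewrite GRing.mul1r GRing.mulrC Num.Theory.ler_pdivlMr ?Num.Theory.ltr0n //.
by rewrite -GRing.natrM Num.Theory.ler_nat mulnC; right.
Qed.

Lemma degree_spanning F v :
  degree (v : vertex (spanning_subgraph F)) = #|[set e in F | v \in ends e]|.
Proof.
rewrite /degree -(card_imset _ val_inj); apply: eq_card => e; rewrite inE.
apply/imsetP/andP => [[f + ->]|[eF ve]]; first by rewrite inE => vf; split=> //; apply: (valP f).
by exists (Sub e eF : edge (spanning_subgraph F)); rewrite ?inE.
Qed.

End Graph.

Lemma adj_spanningP (G : mgraph) (F : {set edge G}) (S : {set vertex G}) x y :
  reflect [/\ x \notin S, y \notin S & exists2 e, e \in F & ends e = [set x; y]]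
    (@adj_minus (spanning_subgraph F) S x y).
Proof.
apply: (iffP (@adj_minusP (spanning_subgraph F) S x y)) => -[xS yS [e]].
  by move=> E; split=> //; exists (val e) => //; apply: (valP e).
by move=> eF E; split=> //; exists (Sub e eF).
Qed.

Lemma odd_sum (I : finType) (A : {set I}) (f : I -> nat) :
  odd (\sum_(i in A) f i) = odd #|[set i in A | odd (f i)]|.
Proof.
rewrite (eq_bigr (fun i => odd (f i) + (f i)./2.*2)); last by move=> i _; rewrite odd_double_half.
rewrite big_split oddD /= [odd (\sum_(i in A) (f i)./2.*2)](big_morph odd oddD (erefl _)).
rewrite [X in addb _ X]big1 => [|i _]; last by rewrite odd_double.
rewrite addbF -big_mkcondr /= sum1_card; congr odd.
by apply: eq_card => i; rewrite inE.
Qed.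

(** * Two-connectedness of the union *)

Section TwoConnected.

Variables (G : mgraph) (F : {set edge G}).
Hypothesis deg2 : forall v : vertex G, #|[set e in F | v \in ends e]| = 2.
Local Notation V := (vertex G).
Local Notation rF := (@adj_minus (spanning_subgraph F) set0).

(** Components are represented by their canonical roots, which makes them a finite type that can
    serve as the type of nodes. *)
Definition component := {x : V | fingraph.root rF x == x}.

Lemma root_component x : fingraph.root rF (fingraph.root rF x) == fingraph.root rF x.
Proof. by apply/eqP/root_root/(@connect_adj_sym (spanning_subgraph F)). Qed.

Definition component_of (x : V) : component := exist _ (fingraph.root rF x) (root_component x).

Lemma component_of_connect x y : (component_of x == component_of y) = connect rF x y.
Proof.
by rewrite -val_eqE; apply: root_connect; apply: (@connect_adj_sym (spanning_subgraph F)).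
Qed.

Lemma component_of_val (n : component) : component_of (val n) = n.
Proof. by apply: val_inj => /=; apply/eqP; apply: (valP n). Qed.

Lemma component_of_edge e : e \in F -> exists n, e \in inside (@ends G) component_of [set n].
Proof.
move=> eF; have [x [y [_ E]]] := endsE e; exists (component_of x).
apply/insideP=> v; rewrite E !inE => /orP[]/eqP-> //.
rewrite eq_sym component_of_connect connect1 //.
by apply/adj_spanningP; rewrite !inE; split=> //; exists e.
Qed.

Variable M : {set edge G}.
Hypotheses (spM : sparse (@ends G) component_of M) (mM : matching (@ends G) M).
Hypothesis cM : #|M| + 2 = 2 * #|{: component}|.

(** An edge of [F] stays within one component, where sparsity for a singleton leaves no room for an
    edge of [M]. *)
Lemma sparse_disjoint e : e \in F -> e \notin M.
Proof.
move=> /component_of_edge[n en]; apply/negP=> eM.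
have n0 : [set n] != set0 by rewrite -card_gt0 cards1.
have := sparseP _ _ _ spM _ n0; rewrite cards1 (cardsD1 e) inE eM en; lia.
Qed.

Lemma degree_union v : #|[set e in F :|: M | v \in ends e]| \in pred2 2 3.
Proof.
have := cardsID F [set e in F :|: M | v \in ends e].
have -> : [set e in F :|: M | v \in ends e] :&: F = [set e in F | v \in ends e].
  by apply/setP=> e; rewrite !inE; case: (e \in F); rewrite ?andbF ?andbT.
rewrite deg2 => <-; have := forallP mM v.
have -> : [set e in F :|: M | v \in ends e] :\: F = [set e in M | v \in ends e].
  apply/setP=> e; rewrite !inE; case: (boolP (e \in F)) => //= /sparse_disjoint/negPf->.
  by [].
by case: #|_| => [|[|]].
Qed.

Definition meets (e : edge G) (W : {set V}) := ~~ [disjoint ends e & W].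

Lemma meetsP e (W : {set V}) : reflect (exists2 x, x \in ends e & x \in W) (meets e W).
Proof.
by apply: (iffP pred0Pn) => [[x /andP[]]|[x xe xW]]; exists x => //; apply/andP.
Qed.

(* Two edges of [M] leave [W], but only one of them can be at [v]. *)
Lemma crossing_of_closed v (W W' : {set V}) :
  W != set0 -> v \notin W -> (forall x, [|| x == v, x \in W | x \in W']) ->
  (forall e, e \in F -> v \in ends e -> ~~ meets e W) ->
  exists e, [&& e \in F :|: M, meets e W & meets e W'].
Proof.
move=> /set0Pn[w wW] vW cov noF; apply/existsP; apply: contraT.
rewrite negb_exists => /forallP nocross.
have leave e : e \in F :|: M -> meets e W -> ends e \subset W \/ v \in ends e.
  move=> eH eW; case: (boolP (ends e \subset W)) => [|/subsetPn[x xe xW]]; [by left|right].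
  have := cov x; rewrite (negPf xW) /= => /orP[/eqP<-//|xW'].
  have /negP[] := nocross e; rewrite eH eW; apply/meetsP; by exists x.
(* No edge of [F] joins [W] to [v] or to [W'], so [W] is a union of components of [F]. *)
have closedW x y : rF x y -> x \in W -> y \in W.
  case/adj_spanningP=> _ _ [e eF E] xW.
  have eW : meets e W by apply/meetsP; exists x => //; rewrite E set21.
  case: (leave e _ eW); first by rewrite inE eF.
    by move/subsetP; apply; rewrite E set22.
  by move/(noF e eF); rewrite eW.
have connW x y : component_of x = component_of y -> x \in W -> y \in W.
  move/eqP; rewrite component_of_connect => /connectP[s + ->].
  by elim: s x => //= z s IH x /andP[/closedW xz /IH zs] /xz.
pose X := component_of @: W.
have XE x : (component_of x \in X) = (x \in W).
  by apply/imsetP/idP => [[y yW /esym/connW]|]; [apply|exists x].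
have X0 : X != set0 by apply/set0Pn; exists (component_of w); rewrite XE.
have XC0 : ~: X != set0 by apply/set0Pn; exists (component_of v); rewrite inE XE.
have := two_crossing spM cM X0 XC0; apply: contraTT => _; rewrite -ltnNge ltnS.
apply: leq_trans (forallP mM v); apply/subset_leq_card/subsetP=> e.
rewrite in_setD in_setU negb_or inE => /andP[/andP[eX eXC] eM]; rewrite eM /=.
have eW : meets e W.
  apply: contraR eXC => eW; apply/insideP=> x xe; rewrite inE XE.
  by apply: contra eW => xW; apply/meetsP; exists x.
case: (leave e _ eW) => //; first by rewrite inE eM orbT.
by move=> /subsetP sW; case/negP: eX; apply/insideP=> x /sW; rewrite XE.
Qed.

(* The number of edges of [F] leaving [W] is even, and they all end at [v]. *)
Lemma crossing_edge v (W W' : {set V}) :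
  W != set0 -> W' != set0 -> v \notin W -> v \notin W' -> [disjoint W & W'] ->
  (forall x, [|| x == v, x \in W | x \in W']) ->
  exists e, [&& e \in F :|: M, meets e W & meets e W'].
Proof.
move=> W0 W'0 vW vW' dis cov.
pose at_v (U : {set V}) := [set e in F | (v \in ends e) && meets e U].
have none (U : {set V}) : #|at_v U| = 0 -> forall e, e \in F -> v \in ends e -> ~~ meets e U.
  move=> /eqP; rewrite cards_eq0 => /eqP/setP at0 e eF ve.
  by have := at0 e; rewrite !inE eF ve => /negbT.
have [/none|a_gt0] := posnP #|at_v W|; first exact: crossing_of_closed.
have [/none noW'|b_gt0] := posnP #|at_v W'|.
  have cov' x : [|| x == v, x \in W' | x \in W] by rewrite [(x \in W') || _]orbC.
  have [e] := crossing_of_closed W'0 vW' cov' noW'.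
  by exists e; rewrite [meets e W && _]andbC.
apply/existsP; apply: contraT; rewrite negb_exists => /forallP nocross.
(* The two edges of [F] at [v] are thus split evenly, one towards each side, so exactly one edge of
   [F] leaves [W], against parity. *)
have sum2 : #|at_v W| + #|at_v W'| <= 2.
  rewrite -(deg2 v) -cardsUI [X in _ + X]eq_card0 ?addn0.
    by apply/subset_leq_card/subsetP=> e; rewrite !inE => /orP[]/and3P[-> ->].
  move=> e; rewrite !inE; apply/negP=> /andP[/and3P[eF ve eW] /and3P[_ _ eW']].
  by have /negP[] := nocross e; rewrite inE eF eW.
have handW := handshake (@ends G) F W.
rewrite (eq_bigr (fun=> 2)) ?sum_nat_const in handW; last by move=> x _; apply: deg2.
have : odd (#|W| * 2) = odd #|at_v W|; last first.
  by rewrite oddM andbF (_ : #|at_v W| = 1) //; move: a_gt0 b_gt0 sum2; clear; lia.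
rewrite handW odd_sum; congr (odd #|pred_of_set _|); apply/setP=> e; rewrite !inE.
case: (boolP (e \in F)) => //= eF.
case: (boolP (meets e W)) => [eW|]; last by rewrite andbF negbK -setI_eq0 => /eqP->; rewrite cards0.
rewrite andbT; case: (boolP (ends e \subset W)) => eW1.
  by rewrite (setIidPl eW1) card_ends; apply/esym/negP=> /(subsetP eW1); rewrite (negPf vW).
have ->: v \in ends e.
  have /subsetPn[x xe xW] := eW1; have := cov x; rewrite (negPf xW) /= => /orP[/eqP<-//|xW'].
  by have /negP[] := nocross e; rewrite inE eF eW; apply/meetsP; exists x.
have : 0 < #|ends e :&: W| < 2; last by case: #|_| => [|[|]].
rewrite card_gt0 setI_eq0 -/(meets e W) eW -(card_ends e) proper_card // properEneq subsetIl andbT.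
by apply: contraNneq eW1 => <-; apply: subsetIr.
Qed.

(** Otherwise [crossing_edge] gives an edge from the component of [x] in the graph without [v] to
    the remaining vertices, which is absurd. *)
Lemma connect_minus1 v x y : x != v -> y != v ->
  connect (@adj_minus (spanning_subgraph (F :|: M)) [set v]) x y.
Proof.
move=> xv yv; set r := adj_minus _; pose W := [set z | connect r x z].
have xW : x \in W by rewrite inE connect0.
have Wv : v \notin W.
  have cl := @adj_closed (spanning_subgraph (F :|: M)) [set v].
  by apply/negP; rewrite inE => /(closed_connect cl); rewrite !inE xv eqxx.
apply: contraT => yW.
have [|||||z|e /and3P[eH]] := @crossing_edge v W (~: (v |: W)).
- by apply/set0Pn; exists x.
- by apply/set0Pn; exists y; rewrite !inE negb_or yv.
- by [].
- by rewrite !inE eqxx.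
- by rewrite disjoints_subset setCK subsetUr.
- by rewrite in_setC in_setU1 orbA orbN.
case/meetsP=> a ae aW /meetsP[b be]; rewrite in_setC in_setU1 => /norP[bv bW].
have ab : a != b by apply: contraNneq bW => <-.
case/negP: bW; move: (aW); rewrite !inE => /connect_trans; apply; apply: connect1.
apply/adj_spanningP; rewrite !inE bv; split=> //; first by apply: contraNneq Wv => <-.
by exists e => //; apply: ends_eq.
Qed.

(** With at least three vertices, any two are joined even after the deletion of some third one, so
    connectedness follows from [connect_minus1] too. *)
Lemma two_connected_union : 3 <= graph_order G -> two_connected (spanning_subgraph (F :|: M)).
Proof.
pose H := spanning_subgraph (F :|: M).
move=> ge3; have third (x y : V) : exists v, v \notin [set x; y].
  apply/existsP; rewrite -negb_forall; apply/forallP=> full.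
  have := leq_trans ge3 (subset_leq_card (introT subsetP (fun v _ => full v))).
  by rewrite cards2; case: eqP.
have le1 : omega_minus (set0 : {set vertex H}) <= 1.
  apply: omega_le1 => x y _ _; have [v] := third x y; rewrite !inE negb_or => /andP[vx vy].
  have := connect_minus1 (_ : x != v) (_ : y != v); rewrite ![_ == v]eq_sym => /(_ vx vy).
  apply: connect_sub => a b /adj_spanningP[_ _ ab]; apply: connect1.
  by apply/adj_spanningP; rewrite !inE.
have ge1 : 0 < omega_minus (set0 : {set vertex H}).
  have [v _] : exists v : V, v \in V by apply/card_gt0P; apply: leq_trans ge3.
  apply: leq_trans (@omega_ge H _ set0 (fun=> tt) _) => //.
  by apply/card_gt0P; exists tt; apply/imsetP; exists v; rewrite ?inE.
split=> //; first by apply/eqP; rewrite eqn_leq le1.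
move=> v; apply/negP; rewrite -leqNgt; apply: leq_trans ge1.
by apply: omega_le1 => x y; rewrite !inE; apply: connect_minus1.
Qed.

End TwoConnected.

Theorem theorem1p3 (R : realType) (G : mgraph)
    (order_ge3 : 3 <= graph_order G)
    (tough16 : tough (16%:R : R)%R G)
    (factor_girth5 : exists (F : {set edge G}) (g : nat),
       [/\ is_factor (pred1 2) F, is_girth (spanning_subgraph F) g & 5 <= g]) :
  exists H : {set edge G},
    is_factor (pred2 2 3) H /\ two_connected (spanning_subgraph H).
Proof.
have [F [g [deg2 [_ girth] g5]]] := factor_girth5.
have degF v : #|[set e in F | v \in ends e]| = 2.
  by rewrite -degree_spanning; apply/eqP/(deg2 v).
(* Each component of [F] contains a cycle, so its order is at least the girth. *)
have fiber5 (n : component F) : 5 <= #|@component_of G F @^-1: [set n]|.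
  have deg2' u : @degree (spanning_subgraph F) u = 2 by apply/eqP/(deg2 u).
  have [k le_k /girth le_g] := cycle_in_component (val n : vertex (spanning_subgraph F)) deg2'.
  apply: leq_trans g5 (leq_trans le_g (leq_trans le_k _)).
  apply/subset_leq_card/subsetP=> u; rewrite !inE -component_of_connect => /eqP <-.
  by rewrite component_of_val.
have [x _] : exists x : vertex G, x \in vertex G.
  by apply/card_gt0P; apply: leq_trans order_ge3.
have comp_gt0 : 0 < #|{: component F}| by apply/card_gt0P; exists (component_of F x).
have [|M [spM mM cM]] := exists_sparse_matching (@card_ends G) fiber5 _ comp_gt0.
  move=> U p pE; have := omega_ge pE; have := tough16_nat U tough16.
  move: #|_ @: _| #|U| (omega_minus U); clear; lia.
exists (F :|: M); split; last exact: two_connected_union.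
by move=> v; rewrite degree_spanning; apply: degree_union.
Qed.
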